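(* Let $d\in\mathbb{N}$, let $\mathcal{X}=\{\boldsymbol{x}_0,\dots,\boldsymbol{x}_{M-1}\}\subset\mathbb{T}^d$ be an arbitrary sampling set with separation distance $0<q\le\frac12$, and let $N\in2\mathbb{N}$ with $N>2dq^{-1}$. Then the nonequispaced Fourier matrix $\boldsymbol{A}=(e^{2\pi i\boldsymbol{k}\cdot\boldsymbol{x}_j})_{j=0,\dots,M-1;\,\boldsymbol{k}\in I_N}\in\mathbb{C}^{M\times N^d}$ has full rank $M$. Moreover, let $\boldsymbol{K}_N=\boldsymbol{A}\hat{\boldsymbol{W}}\boldsymbol{A}^{*}=(K_N(\boldsymbol{x}_j-\boldsymbol{x}_l))_{j,l=0,\dots,M-1}$ be the kernel matrix obtained from the (tensor product) B-spline kernel $K_N(\boldsymbol{x})=\prod_{t=0}^{d-1}B_{\beta,N}(x_t)$ of order $\beta=d+1$. Then its smallest eigenvalue $\lambda$ and largest eigenvalue $\Lambda$ satisfy $$0<1-\left(\frac{2d}{Nq}\right)^{d+1}\le\lambda\le1\le\Lambda\le1+\left(\frac{2d}{Nq}\right)^{d+1}.$$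
   Context: $\mathbb{T}=[-\frac12,\frac12)$ is the torus (reals modulo 1), $I_N=\{-\frac N2,\dots,\frac N2-1\}^d$, $\operatorname{dist}(\boldsymbol{x},\boldsymbol{y})=\min_{\boldsymbol{j}\in\mathbb{Z}^d}\|\boldsymbol{x}+\boldsymbol{j}-\boldsymbol{y}\|_\infty$, and the separation distance of $\mathcal{X}$ is $q=\min_{j\ne l}\operatorname{dist}(\boldsymbol{x}_j,\boldsymbol{x}_l)$. $\boldsymbol{A}^*$ is the conjugate transpose. B-spline kernel: the cardinal B-splines are $N_1(z)=1$ for $z\in(0,1)$, $N_1(z)=0$ elsewhere, and $N_{\beta+1}(z)=\int_{z-1}^zN_\beta(\tau)\,\mathrm{d}\tau$. The normalised B-spline is $g_\beta(z)=\beta N_\beta(\beta z+\frac\beta2)$, and $\|g_\beta\|_{1,N}=\sum_{k=-N/2}^{N/2}g_\beta(k/N)$. The univariate B-spline kernel is $$B_{\beta,N}(x)=\frac{1+e^{-2\pi ix}}{2\|g_\beta\|_{1,N}}\sum_{k=-N/2}^{N/2}g_\beta\left(\frac kN\right)e^{2\pi ikx}.$$ The diagonal matrix $\hat{\boldsymbol{W}}=\operatorname{diag}(\hat w_{\boldsymbol{k}})_{\boldsymbol{k}\in I_N}$ consists of the Fourier coefficients of $K_N$, i.e. $K_N(\boldsymbol{x})=\sum_{\boldsymbol{k}\in I_N}\hat w_{\boldsymbol{k}}e^{2\pi i\boldsymbol{k}\cdot\boldsymbol{x}}$; explicitly $\hat w_{\boldsymbol{k}}=\prod_{t=0}^{d-1}\frac{g_\beta(k_t/N)+g_\beta((k_t+1)/N)}{2\|g_\beta\|_{1,N}}$.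 *)

(* Defs.v *)
From HB Require Import structures.
From mathcomp Require Import all_boot all_order all_algebra.
From mathcomp Require Import all_classical all_reals all_analysis.
From mathcomp Require Import complex.
From mathcomp Require Import lra zify.

Set Implicit Arguments.
Unset Strict Implicit.
Unset Printing Implicit Defensive.

Import Order.TTheory GRing.Theory Num.Theory.
Import numFieldNormedType.Exports.

Local Open Scope classical_set_scope.
Local Open Scope ring_scope.
Local Open Scope complex_scope.

Definition is_min {disp} {T : porderType disp} (A : set T) (m : T) : Prop :=
  A m /\ lbound A m.

Definition is_max {disp} {T : porderType disp} (A : set T) (m : T) : Prop :=
  A m /\ ubound A m.

(* The torus is represented by the fundamental domain [-1/2, 1/2). *)
Definition torus {R : realType} {d : nat} : set 'rV[R]_d :=
  [set x | forall t, - 2^-1 <= x 0 t < 2^-1].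

(* The norm on 'rV[R]_d is the sup norm.  The infimum is a minimum: see
   [torus_dist_is_min]. *)
Definition torus_dist {R : realType} {d : nat} (x y : 'rV[R]_d) : R :=
  inf [set `|x + map_mx intr j - y| | j in [set: 'rV[int]_d]].

(* No q satisfies this for fewer than two points. *)
Definition is_separation_distance {R : realType} {d M : nat}
    (x : 'I_M -> 'rV[R]_d) (q : R) : Prop :=
  is_min [set r | exists j l : 'I_M, j != l /\ r = torus_dist (x j) (x l)] q.

(* e^(2 pi i x) *)
Definition e2pi {R : realType} (x : R) : R[i] :=
  cos (2 * pi * x) +i* sin (2 * pi * x).

(* The order is beta, as in N_beta; the value at order 0 is a dummy. *)
Fixpoint cardinal_bspline {R : realType} (beta : nat) : R -> R :=
  match beta with
  | 0 => fun=> 0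
  | 1 => \1_(`]0, 1[%classic)
  | b.+1 => fun z =>
      Rintegral lebesgue_measure `[z - 1, z] (cardinal_bspline b)
  end.

Definition normalised_bspline {R : realType} (beta : nat) (z : R) : R :=
  beta%:R * cardinal_bspline beta (beta%:R * z + beta%:R / 2).

(* m = 0, ..., N - 1 is sent to -N/2, ..., N/2 - 1 (and m = N to N/2). *)
Definition centered (N m : nat) : int := m%:Z - (N./2)%:Z.

Definition bspline_norm1 (R : realType) (beta N : nat) : R :=
  \sum_(0 <= m < N.+1) normalised_bspline beta ((centered N m)%:~R / N%:R).

Definition bspline_kernel1 {R : realType} (beta N : nat) (x : R) : R[i] :=
  (1 + e2pi (- x)) / (2 * (bspline_norm1 R beta N)%:C) *
  \sum_(0 <= m < N.+1)
    (normalised_bspline beta ((centered N m)%:~R / N%:R))%:C *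
    e2pi ((centered N m)%:~R * x).

Definition bspline_kernel {R : realType} {d : nat} (beta N : nat)
    (x : 'rV[R]_d) : R[i] :=
  \prod_(t < d) bspline_kernel1 beta N (x 0 t).

(* I_N is encoded by functions 'I_d -> 'I_N, read through [centered]. *)
Notation freq_index d N := {ffun 'I_d -> 'I_N}.

Definition freq {d N : nat} (k : freq_index d N) (t : 'I_d) : int :=
  centered N (k t).

Definition fourier_matrix {R : realType} {d M : nat} (N : nat)
    (x : 'I_M -> 'rV[R]_d) : 'M[R[i]]_(M, #|freq_index d N|) :=
  \matrix_(j, c) e2pi (\sum_(t < d) (freq (enum_val c) t)%:~R * x j 0 t).

Definition weight (R : realType) {d N : nat} (beta : nat)
    (k : freq_index d N) : R :=
  \prod_(t < d)
    ((normalised_bspline beta ((freq k t)%:~R / N%:R) +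
      normalised_bspline beta ((freq k t + 1)%:~R / N%:R)) /
     (2 * bspline_norm1 R beta N)).

Definition weight_matrix (R : realType) (d beta N : nat) :
    'M[R[i]]_#|freq_index d N| :=
  diag_mx (\row_c (weight R beta (enum_val c))%:C).

Definition kernel_matrix {R : realType} {d M : nat} (beta N : nat)
    (x : 'I_M -> 'rV[R]_d) : 'M[R[i]]_M :=
  fourier_matrix N x *m weight_matrix R d beta N *m
  (fourier_matrix N x)^t*%sesqui.

(* On R[i], [a <= b] says that b - a is a nonnegative real; hence a real
   least or greatest element of the spectrum forces a real spectrum. *)
Definition spectrum {R : realType} {n : nat} (K : 'M[R[i]]_n) : set R[i] :=
  [set a | eigenvalue K a].

Definition smallest_eigenvalue {R : realType} {n : nat} (K : 'M[R[i]]_n)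
    (lambda : R) : Prop := is_min (spectrum K) lambda%:C.

Definition largest_eigenvalue {R : realType} {n : nat} (K : 'M[R[i]]_n)
    (Lambda : R) : Prop := is_max (spectrum K) Lambda%:C.

Lemma floor_half_nearest {R : realType} (z : R) (m : int) :
  `|z - (Num.floor (z + 2^-1))%:~R| <= `|z + m%:~R|.
Proof.
set f := Num.floor _; have /andP[f1] := floor_itv (z + 2^-1); rewrite -/f in f1 *.
rewrite intrD => f2.
have [h|[h|h]] : (m = - f \/ (m + f + 1 <= 0)%R \/ (1 <= m + f)%R) by lia.
- by rewrite h mulrNz.
- have : (m + f + 1)%:~R <= 0 :> R by rewrite lerz0.
  rewrite !intrD => h'.
  by rewrite ler_norml; have := ler_norm (- (z + m%:~R)); rewrite normrN; lra.
- have : 1 <= (m + f)%:~R :> R by rewrite ler1z.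
  rewrite !intrD => h'.
  by rewrite ler_norml; have := ler_norm (z + m%:~R); lra.
Qed.

Lemma torus_dist_is_min {R : realType} {d : nat} (x y : 'rV[R]_d) :
  is_min [set `|x + map_mx intr j - y| | j in [set: 'rV[int]_d]]
         (torus_dist x y).
Proof.
set S := [set _ | _ in _].
pose j0 : 'rV[int]_d := \row_t - Num.floor (x 0 t - y 0 t + 2^-1).
have Sj0 : S `|x + map_mx intr j0 - y| by exists j0.
have lbS : lbound S `|x + map_mx intr j0 - y|.
  move=> _ [j _ <-]; rewrite {1}/Num.Def.normr /= mx_normrE.
  apply: bigmax_le => // -[i t] _ /=; rewrite (ord1 i).
  have -> : (x + map_mx intr j0 - y) 0 t =
      x 0 t - y 0 t - (Num.floor (x 0 t - y 0 t + 2^-1))%:~R.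
    by rewrite !mxE mulrNz addrAC.
  apply: (le_trans (floor_half_nearest _ (j 0 t))).
  have -> : x 0 t - y 0 t + (j 0 t)%:~R = (x + map_mx intr j - y) 0 t.
    by rewrite !mxE addrAC.
  rewrite [leRHS]/Num.Def.normr /= mx_normrE.
  exact: (le_bigmax _ (fun p => `|(x + map_mx intr j - y) p.1 p.2|) (0, t)).
suff e : torus_dist x y = `|x + map_mx intr j0 - y| by split; rewrite e.
apply/eqP; rewrite eq_le; apply/andP; split.
  by apply: ge_inf => //; exists `|x + map_mx intr j0 - y|.
by apply: lb_le_inf => //; exists `|x + map_mx intr j0 - y|.
Qed.

(* Main.v *)
Require Import Defs.
From mathcomp Require Import all_boot all_order all_algebra.
From mathcomp Require Import all_classical all_reals all_analysis.
From mathcomp Require Import measurable_realfun complex.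
From mathcomp Require Import ring lra zify.

(** The kernel matrix is Hermitian with unit diagonal, so by Gershgorin's theorem
    its eigenvalues differ from 1 by at most the largest off-diagonal row sum,
    and they have mean 1 because its trace is M
    ([near_identity_eigenvalues]). It remains to show that the row sums are at
    most rho = (2 d / (N q)) ^ (d + 1) < 1; then the kernel matrix, and hence
    the Fourier matrix, has rank M.

    Localisation of the kernel. Put beta = d + 1 and delta = beta / N. The
    univariate kernel is, up to a phase,
    cos (pi x) * P (x) / P (0) with
    P (x) = sum over m of N_beta (delta m) exp (2 pi i m x).
    The recursion that defines the B-splines carries over to the sums with
    shifted grids s + delta Z. Such a sum is quasi-periodic in s with period
    delta, so its integral over a window of length one is a difference of two
    integrals over windows of length delta, divided by a factor of modulus
    2 |sin (pi x)|. Hence each order gains delta / |sin (pi x)|, and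
    |P (x)| <= delta ^ (beta - 1) / |sin (pi x)| ^ beta
    ([spline_sum_decay]). The same recursion preserves the lower bound
    P (0) >= 1 / delta - 1 ([spline_sum_ge]). With
    |cos (pi x)| (2 |x|) ^ beta <= |sin (pi x)| ^ beta / 2
    ([cos_sin_decay]) this gives
    |B (x)| <= (delta / (2 |x|)) ^ beta / (2 (1 - delta))
    ([norm_bspline_kernel1_decay]). Since |B| <= 1, the tensor product kernel
    obeys the same bound in the sup norm.

    Summation. The nodes seen from a fixed node are q-separated and at distance
    at least q from it. Counting them in shells of width q bounds the sum of
    (q / distance) ^ (d + 1) by 2 ^ d (2 ^ d - 1) times the sum of 1 / k ^ 2,
    which is at most 5 / 3 ([sum_separated_le]). As q <= 1 / 2 forces
    N > 4 d, the product of all constants is at most rho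
    ([gershgorin_constant_le]). *)

Set Implicit Arguments.
Unset Strict Implicit.
Unset Printing Implicit Defensive.

Import Order.TTheory GRing.Theory Num.Theory.
Import numFieldNormedType.Exports.
Local Open Scope ring_scope.

(** * Window integrals of bounded measurable functions *)

Section WindowIntegrals.
Local Open Scope classical_set_scope.
Variable R : realType.
Implicit Types (f g : R -> R) (a b c s z : R).

(** A class that contains the discontinuous first B-spline, is stable under
    translations, finite sums and unit-window integrals, and guarantees
    integrability on every bounded interval. *)
Definition bounded_measurable f :=
  measurable_fun [set: R] f /\ exists B, forall x, `|f x| <= B.

Local Notation itg a b f := (Rintegral (@lebesgue_measure R) `[a, b]%classic f).

Lemma bounded_measurable_integrable f a b : bounded_measurable f ->
  (@lebesgue_measure R).-integrable `[a, b]%classic (EFin \o f).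
Proof.
move=> [mf [B fB]]; apply: measurable_bounded_integrable => //.
- by rewrite /= lebesgue_measure_itv /=; case: ifP => // _; rewrite -EFinB ltry.
- exact: measurable_funTS.
- exists B; split; first by rewrite num_real.
  by move=> M BM x _; apply: (le_trans (fB x)); apply: ltW.
Qed.

Lemma bounded_measurable_shift f c :
  bounded_measurable f -> bounded_measurable (fun t => f (c + t)).
Proof.
move=> [mf [B fB]]; split; last by exists B.
apply: (measurableT_comp mf).
exact: measurable_funD.
Qed.

Lemma bounded_measurableZ k f :
  bounded_measurable f -> bounded_measurable (fun t => k * f t).
Proof.
move=> [mf [B fB]]; split; first exact: measurable_funM.
by exists (`|k| * B) => x; rewrite normrM ler_wpM2l.
Qed.

Lemma bounded_measurable_lin (I : Type) (r : seq I) (u : I -> R)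
    (F : I -> R -> R) : (forall i, bounded_measurable (F i)) ->
  bounded_measurable (fun t => \sum_(i <- r) u i * F i t).
Proof.
move=> mF; elim: r => [|i r [mS [B SB]]].
  under eq_fun do rewrite big_nil.
  by split; [exact: measurable_cst | exists 0 => x; rewrite normr0].
under eq_fun do rewrite big_cons.
have [mi [C FC]] := bounded_measurableZ (u i) (mF i); split.
  exact: measurable_funD.
by exists (C + B) => x; apply: (le_trans (ler_normD _ _)); apply: lerD.
Qed.

Lemma Rintegral_lin (I : Type) (r : seq I) (u : I -> R)
    (F : I -> R -> R) a b : (forall i, bounded_measurable (F i)) ->
  itg a b (fun t => \sum_(i <- r) u i * F i t) =
  \sum_(i <- r) u i * itg a b (F i).
Proof.
move=> mF; elim: r => [|i r IHr].
  under eq_Rintegral do rewrite big_nil.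
  by rewrite big_nil Rintegral_cst // mul0r.
under eq_Rintegral do rewrite big_cons.
have m1 := bounded_measurable_integrable a b (bounded_measurable_lin r u mF).
have mi := bounded_measurable_integrable a b (mF i).
rewrite big_cons RintegralD // ?RintegralZl ?IHr //.
exact/bounded_measurable_integrable/bounded_measurableZ.
Qed.

Lemma Rintegral_split f a b c : bounded_measurable f -> a <= b -> b <= c ->
  itg a c f = itg a b f + itg b c f.
Proof.
move=> mf ab bc.
have ic x y := bounded_measurable_integrable x y mf.
have := Rintegral_itvB (ic a c) (x := b).
rewrite !bnd_simp => /(_ ab bc) H.
rewrite -(@Rintegral_itv_obnd_cbnd _ b) ?H; last first.
  by apply: integrableS (ic b c) => //; apply: subset_itvr; rewrite bnd_simp.
by rewrite -H addrCA subrr addr0.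
Qed.

Lemma Rintegral_itv_cst a b (B : R) : a <= b -> itg a b (fun=> B) = B * (b - a).
Proof.
move=> ab; rewrite Rintegral_cst //= lebesgue_measure_itv /= lte_fin.
by case: ltP => // ba; rewrite (le_anti (introT andP (conj ab ba))) subrr.
Qed.

Lemma bounded_measurable_cst (B : R) : bounded_measurable (fun=> B).
Proof. by split; [exact: measurable_cst | exists `|B|]. Qed.

Lemma ge_Rintegral_itv f a b (B : R) : bounded_measurable f -> a <= b ->
  (forall x, a <= x <= b -> B <= f x) -> B * (b - a) <= itg a b f.
Proof.
move=> mf ab fB; rewrite -Rintegral_itv_cst //.
by apply: le_Rintegral => //; apply: bounded_measurable_integrable => //;
  exact: bounded_measurable_cst.
Qed.

Lemma le_Rintegral_itv f a b (B : R) : bounded_measurable f -> a <= b ->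
  (forall x, a <= x <= b -> f x <= B) -> itg a b f <= B * (b - a).
Proof.
move=> mf ab fB; rewrite -Rintegral_itv_cst //.
by apply: le_Rintegral => //; apply: bounded_measurable_integrable => //;
  exact: bounded_measurable_cst.
Qed.

(** Translation invariance of the Lebesgue integral: pushing the measure forward
    along a translation preserves the length of half-open intervals, hence the
    measure. A change of variables for continuous integrands would not cover
    the first B-spline. *)
Lemma Rintegral_shift f a b c : bounded_measurable f ->
  itg a b (fun t => f (c + t)) = itg (c + a) (c + b) f.
Proof.
move=> mf.
pose phi : measurableTypeR R -> measurableTypeR R := fun t => c + t.
have mphi : measurable_fun [set: measurableTypeR R] phi by exact: measurable_funD.
have phiV x y : phi @^-1` `[c + x, c + y]%classic = `[x, y]%classic.
  by apply/seteqP; split => t; rewrite /= !in_itv /= !lerD2l.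
pose nu := pushforward (@lebesgue_measure R) phi.
have E A : measurable A -> lebesgue_measure A = nu A.
  apply: (@lebesgue_measure_unique _ nu).
  move=> X [[x y] _ <-]; rewrite /nu /pushforward /=.
  have phiX : phi @^-1` `]x, y]%classic = `]x - c, y - c]%classic.
    by apply/seteqP; split => t; rewrite /= !in_itv /= ltrBlDl lerBrDl.
  rewrite [RHS](congr1 lebesgue_measure phiX). rewrite !lebesgue_measure_itv /= !lte_fin ltrD2r; case: ifP => // _.
  by rewrite -!EFinB; congr (_%:E); lra.
rewrite /Rintegral; congr fine.
rewrite -(phiV a b).
have := @integral_pushforward _ _ _ _ R phi mphi lebesgue_measure
  `[c + a, c + b]%classic (EFin \o f).
move=> <- //.
- by apply: eq_measure_integral => A mA _; first [exact: E | exact/esym/E].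
- by apply/measurable_EFinP; case: mf.
- by rewrite phiV; exact: (bounded_measurable_integrable _ _ (bounded_measurable_shift c mf)).
Qed.

(** The window integral is Lipschitz: moving the window from z to w adds and
    removes a piece of length w - z. *)
Lemma bounded_measurable_window f : bounded_measurable f ->
  bounded_measurable (fun z => itg (z - 1) z f).
Proof.
move=> mf; have [_ [B fB]] := mf.
have B0 : 0 <= B by apply: le_trans (fB 0).
have nB a b : a <= b -> `|itg a b f| <= B * (b - a).
  move=> ab; rewrite ler_norml -mulNr.
  by rewrite le_Rintegral_itv ?ge_Rintegral_itv // => x _;
    have := fB x; rewrite ler_norml => /andP[].
split; last first.
  by exists B => z; apply: le_trans (nB _ _ _) _; rewrite ?gerBl // opprB addrCA subrr addr0 mulr1.
have lip z w : z <= w ->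
    `|itg (z - 1) z f - itg (w - 1) w f| <= 2 * B * (w - z).
  move=> zw.
  have e1 : itg (z - 1) w f = itg (z - 1) z f + itg z w f.
    by apply: Rintegral_split => //; rewrite gerBl.
  have e2 : itg (z - 1) w f = itg (z - 1) (w - 1) f + itg (w - 1) w f.
    by apply: Rintegral_split => //; rewrite ?gerBl ?lerD2r.
  have -> : itg (z - 1) z f - itg (w - 1) w f = itg (z - 1) (w - 1) f - itg z w f by lra.
  have n1 : `|itg (z - 1) (w - 1) f| <= B * (w - z).
    by apply: le_trans (nB _ _ _) _; rewrite ?lerD2r // opprB addrA subrK.
  apply: le_trans (ler_normB _ _) _.
  by have := nB _ _ zw; lra.
apply: continuous_measurable_fun => z.
apply/cvgrPdist_le => /= e e0; near=> w.
have zw : `|z - w| <= e / (2 * B + 1).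
  by near: w; apply: cvgr_dist_le => //; rewrite divr_gt0 // ltr_wpDl // mulr_ge0.
have L : `|itg (z - 1) z f - itg (w - 1) w f| <= 2 * B * `|z - w|.
  have [h|/ltW h] := leP z w.
    by rewrite [`|z - w|]distrC [`|w - z|]ger0_norm ?subr_ge0 //; exact: lip.
  by rewrite distrC [`|z - w|]ger0_norm ?subr_ge0 //; exact: lip.
apply: (le_trans L).
move: zw; rewrite ler_pdivlMr; last by rewrite ltr_wpDl // mulr_ge0.
have := normr_ge0 (z - w); nra.
Unshelve. all: by end_near. Qed.

End WindowIntegrals.

(** * Exponential sums with B-spline coefficients *)

Section SplineSums.
Variable R : realType.
Implicit Types (s t z theta : R).

Local Notation itg a b f := (Rintegral (@lebesgue_measure R) `[a, b]%classic f).
Local Notation spline := (@cardinal_bspline R).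

Lemma cardinal_bsplineS b z :
  spline b.+2 z = itg (z - 1) z (spline b.+1).
Proof. by []. Qed.

Lemma cardinal_bspline1 z : spline 1 z = (0 < z < 1)%R%:R.
Proof. by rewrite /= indicE mem_setE in_itv. Qed.

Lemma bounded_measurable_cardinal_bspline b : bounded_measurable (spline b).
Proof.
case: b => [|b]; first exact: bounded_measurable_cst.
elim: b => [|b IHb]; last exact: bounded_measurable_window IHb.
split; first exact: measurable_indic.
by exists 1 => z; rewrite cardinal_bspline1 normr_nat lern1 leq_b1.
Qed.

Lemma cardinal_bspline_ge0 b z : 0 <= spline b z.
Proof.
case: b => [|b]; first exact: lexx.
elim: b z => [|b IHb] z; first by rewrite cardinal_bspline1 ler0n.
by rewrite cardinal_bsplineS; apply: Rintegral_ge0 => t _; exact: IHb.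
Qed.

Lemma cardinal_bspline_eq0 b z : (z <= 0) || (b%:R <= z) -> spline b z = 0.
Proof.
case: b => [|b]; first by [].
elim: b z => [|b IHb] z hz.
  by rewrite cardinal_bspline1; move: hz; case: ltP => //= _ /le_gtF ->.
rewrite cardinal_bsplineS (@eq_Rintegral _ _ _ _ _ (fun=> 0)).
  by rewrite Rintegral_itv_cst ?mul0r // gerBl.
move=> t; rewrite inE /= in_itv /= => /andP[zt tz].
apply: IHb; case/orP: hz => hz; first by rewrite (le_trans tz).
apply/orP; right; apply: le_trans zt; move: hz; rewrite -(natr1 b.+1); lra.
Qed.

(** The sampling points that fall into an interval have consecutive indices;
    each end of that range of indices is such a threshold. *)
Lemma up_closed_threshold (p : pred nat) L : {homo p : m n / (m <= n)%N >-> m ==> n} ->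
  exists2 a, (a <= L)%N & forall m, (m < L)%N -> p m = (a <= m)%N.
Proof.
move=> hp; elim: L => [|L [a aL pa]]; first by exists 0%N.
have [pL|pL] := boolP (p L).
  exists a => [|m]; first exact: leqW.
  by rewrite ltnS leq_eqVlt => /predU1P[->|/pa //]; rewrite pL aL.
exists L.+1 => // m mL; rewrite leqNgt mL /=.
by apply: contraNF pL => pm; move/implyP: (hp m L mL) => ->.
Qed.

(** Summing against the samples of the indicator of the unit interval is summing
    over a range of consecutive indices. A grid of step delta that covers the
    interval has at least 1 / delta - 1 points inside it. *)
Lemma threshold_itv (delta s : R) L : 0 < delta -> exists a b : nat,
  (forall w : nat -> R, \sum_(0 <= m < L) w m * spline 1 (delta * m%:R + s) =
       \sum_(a <= m < b) w m) /\
  (s <= 0 -> 1 <= delta * L%:R + s -> 1 - delta <= delta * (b%:R - a%:R)).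
Proof.
move=> d0.
have mono m n : (m <= n)%N -> delta * m%:R + s <= delta * n%:R + s.
  by move=> mn; rewrite lerD2r ler_pM2l // ler_nat.
have [a aL ha] := @up_closed_threshold (fun m => 0 < delta * m%:R + s) L
  (fun m n mn => introT implyP (fun h => lt_le_trans h (mono m n mn))).
have [b bL hb] := @up_closed_threshold (fun m => 1 <= delta * m%:R + s) L
  (fun m n mn => introT implyP (fun h => le_trans h (mono m n mn))).
exists a, b; split => //.
  move=> w.
  rewrite [RHS](big_nat_widenl _ 0%N) // [RHS](big_nat_widen _ _ L) //.
  rewrite [RHS]big_mkcond; apply: eq_big_nat => m /andP[_ mL].
  rewrite cardinal_bspline1 ltnNge -hb // -ha // -ltNge.
  by case: (0 < _); case: (_ < 1); rewrite ?mulr1 ?mulr0.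
move=> s0 sL.
have hb1 : 1 <= delta * b%:R + s.
  by move: bL; rewrite leq_eqVlt => /predU1P[-> //|bL]; rewrite hb.
have ha1 : delta * a%:R + s <= delta.
  case: a aL ha {mono} => [|a] aL ha; first by rewrite mulr0 add0r (le_trans s0) ?ltW.
  have : ~~ (0 < delta * a%:R + s) by rewrite ha // -ltnNge.
  by rewrite -leNgt -addn1 natrD mulrDr mulr1; lra.
lra.
Qed.

(** The real part of a rotated exponential sum with B-spline coefficients. Letting
    theta vary recovers the modulus of the complex sum, so that only real
    integrals are needed; the offset s is what the recursion integrates over,
    and L is chosen so that the grid covers the support. *)
Definition spline_sum (delta phi : R) b L s theta :=
  \sum_(0 <= m < L) cos (m%:R * phi + theta) * spline b (delta * m%:R + s).

Lemma spline_sum_window delta phi b L s theta :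
  spline_sum delta phi b.+2 L s theta =
  itg (s - 1) s (fun t => spline_sum delta phi b.+1 L t theta).
Proof.
have mF m : bounded_measurable (fun t => spline b.+1 (delta * m%:R + t)).
  exact/bounded_measurable_shift/bounded_measurable_cardinal_bspline.
rewrite Rintegral_lin //; apply: eq_bigr => m _; congr (_ * _).
rewrite cardinal_bsplineS.
rewrite Rintegral_shift; last exact: bounded_measurable_cardinal_bspline.
by rewrite addrA.
Qed.

Lemma bounded_measurable_spline_sum delta phi b L theta :
  bounded_measurable (fun t => spline_sum delta phi b L t theta).
Proof.
apply: bounded_measurable_lin => m.
exact/bounded_measurable_shift/bounded_measurable_cardinal_bspline.
Qed.

(** Multiplication by 1 - exp (i phi) turned into a difference of two phases. *)
Lemma spline_sum_phase delta phi b L s theta :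
  2 * sin (phi / 2) * spline_sum delta phi b L s theta =
  spline_sum delta phi b L s (theta + pi / 2 + phi / 2 - phi) -
  spline_sum delta phi b L s (theta + pi / 2 + phi / 2).
Proof.
rewrite -sumrB big_distrr; apply: eq_bigr => m _ /=.
rewrite mulrA -mulrBl; congr (_ * _).
set A := m%:R * phi + theta.
have -> : m%:R * phi + (theta + pi / 2 + phi / 2 - phi) = (A - phi / 2) + pi / 2.
  by rewrite /A; lra.
have -> : m%:R * phi + (theta + pi / 2 + phi / 2) = (A + phi / 2) + pi / 2.
  by rewrite /A; lra.
by rewrite !cosDpihalf (sinB A) (sinD A); ring.
Qed.

(** Translation by one grid step only changes the phase: the two boundary terms
    vanish because they lie outside the support. *)
Lemma spline_sum_shift delta phi b L t theta :
  t <= 0 -> b%:R <= delta * L%:R + t ->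
  spline_sum delta phi b L (t + delta) theta =
  spline_sum delta phi b L t (theta - phi).
Proof.
move=> t0 tL; rewrite /spline_sum.
pose F m := cos (m%:R * phi + (theta - phi)) * spline b (delta * m%:R + t).
have e1 : \sum_(0 <= m < L.+1) F m = \sum_(0 <= m < L) F m.
  by rewrite big_nat_recr //= /F (@cardinal_bspline_eq0 _ (_ * L%:R + t))
    ?tL ?orbT // mulr0 addr0.
rewrite -[RHS]e1 big_nat_recl //.
rewrite {1}/F (@cardinal_bspline_eq0 _ (_ * 0 + t)) ?mulr0 ?add0r ?t0 //.
apply: eq_bigr => m _.
by rewrite /F -(addn1 m) natrD; congr (cos _ * spline _ _); lra.
Qed.

(** The heart of the localisation estimate. For order one the sum is geometric
    and is at most 1 / |sin (phi / 2)|. In the recursion, multiplication by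
    2 sin (phi / 2) gives the integral over [s - 1, s] of T (t + delta) - T t,
    where T is the previous sum with another phase. This telescopes to two
    integrals over intervals of length delta, so each order gains the factor
    delta / |sin (phi / 2)|. *)
Lemma spline_sum_decay delta phi b L s theta :
  0 < delta -> sin (phi / 2) != 0 ->
  s + b%:R * delta <= 0 -> 2 * b%:R <= delta * L%:R + s ->
  `|spline_sum delta phi b.+1 L s theta| <=
    delta ^+ b / `|sin (phi / 2)| ^+ b.+1.
Proof.
move=> d0; rewrite -normr_gt0; set S := `|_| => S0.
elim: b s theta => [|b IHb] s theta.
  move=> _ _; rewrite expr0 expr1 ler_pdivlMr // mulrC.
  rewrite -[S]gtr0_norm // normr_id -normrM.
  have [a [c [E _]]] := threshold_itv s L d0.
  rewrite /spline_sum (E (fun m => cos (m%:R * phi + theta))).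
  suff : `|2 * (sin (phi / 2) * \sum_(a <= m < c) cos (m%:R * phi + theta))| <= 2.
    by rewrite (normrM 2) (@ger0_norm _ 2) //; lra.
  have -> : 2 * (sin (phi / 2) * \sum_(a <= m < c) cos (m%:R * phi + theta)) =
      \sum_(a <= m < c) (sin (m.+1%:R * phi + (theta - phi / 2)) -
         sin (m%:R * phi + (theta - phi / 2))).
    rewrite !big_distrr; apply: eq_bigr => m _ /=.
    set A := m%:R * phi + theta.
    have -> : m.+1%:R * phi + (theta - phi / 2) = A + phi / 2.
      by rewrite -(addn1 m) natrD /A; lra.
    have -> : m%:R * phi + (theta - phi / 2) = A - phi / 2 by rewrite /A; lra.
    by rewrite (sinB A) (sinD A); ring.
  have [ac|ca] := leqP a c; last by rewrite big_geq ?normr0 // ltnW.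
  rewrite (telescope_sumr (fun m => sin (m%:R * phi + (theta - phi / 2)))) //.
  apply: (le_trans (ler_normB _ _)).
  by have := sin_max (c%:R * phi + (theta - phi / 2));
     have := sin_max (a%:R * phi + (theta - phi / 2)); lra.
rewrite -(addn1 b) natrD => h1 h2.
have b0 : 0 <= b%:R :> R by [].
have bd0 : 0 <= b%:R * delta by rewrite mulr_ge0 // ltW.
set B := delta ^+ b / S ^+ b.+1 in IHb.
have B0 : 0 <= B by rewrite divr_ge0 // exprn_ge0 // ltW.
rewrite addn1 -[S]gtr0_norm // normr_id.
have -> : delta ^+ b.+1 / S ^+ b.+2 = delta * B / S.
  by rewrite /B exprS (exprS S b.+1) invfM; ring.
rewrite ler_pdivlMr // mulrC -[S]gtr0_norm // normr_id -normrM.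
suff : `|2 * (sin (phi / 2) * spline_sum delta phi b.+2 L s theta)| <= 2 * (delta * B).
  by rewrite (normrM 2) (@ger0_norm _ 2) //; lra.
rewrite mulrA spline_sum_phase; set th := theta + _ + _.
rewrite !spline_sum_window.
pose T t := spline_sum delta phi b.+1 L t th.
have mT : bounded_measurable T by exact: bounded_measurable_spline_sum.
have -> : itg (s - 1) s (fun t => spline_sum delta phi b.+1 L t (th - phi)) =
    itg (s - 1) s (fun t => T (delta + t)).
  apply: eq_Rintegral => t; rewrite inE /= in_itv /= => /andP[st ts].
  by rewrite /T (addrC delta) spline_sum_shift //; [lra|rewrite -(addn1 b) natrD; lra].
rewrite Rintegral_shift // -/T.
have e1 : itg (s - 1) (delta + s) T = itg (s - 1) s T + itg s (delta + s) T.
  by apply: Rintegral_split => //; lra.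
have e2 : itg (s - 1) (delta + s) T =
    itg (s - 1) (delta + (s - 1)) T + itg (delta + (s - 1)) (delta + s) T.
  by apply: Rintegral_split => //; lra.
have -> : itg (delta + (s - 1)) (delta + s) T - itg (s - 1) s T =
  itg s (delta + s) T - itg (s - 1) (delta + (s - 1)) T by lra.
(* Only the two ends of the window survive, each of length delta. *)
have bnd u : s - 1 <= u <= s -> `|itg u (delta + u) T| <= delta * B.
  move=> /andP[u1 u2].
  have TB t : u <= t <= delta + u -> - B <= T t <= B.
    by move=> /andP[t1 t2]; rewrite -ler_norml; apply: IHb; lra.
  have uu : u <= delta + u by lra.
  have := le_Rintegral_itv mT uu (fun t ht => proj2 (andP (TB t ht))).
  have := ge_Rintegral_itv mT uu (fun t ht => proj1 (andP (TB t ht))).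
  by rewrite ler_norml; lra.
apply: (le_trans (ler_normB _ _)).
have := bnd s; have := bnd (s - 1); lra.
Qed.

(** A lower bound for the sum of the samples passes from one order to the next
    because integration over a window of length one preserves it. *)
Lemma spline_sum_ge (delta : R) b L s :
  0 < delta -> s <= 0 -> b.+1%:R <= delta * L%:R + s ->
  delta^-1 - 1 <= \sum_(0 <= m < L) spline b.+1 (delta * m%:R + s).
Proof.
move=> d0; elim: b s => [|b IHb] s s0 sL.
  have [a [c [e h]]] := threshold_itv s L d0.
  have := e (fun=> 1); under eq_bigr do rewrite mul1r.
  move=> ->; rewrite sumr_const_nat -(ler_pM2l d0) mulrBr mulfV ?gt_eqF // mulr1.
  apply: (le_trans (h s0 sL)); rewrite ler_pM2l //.
  rewrite lerBlDr -natrD ler_nat; lia.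
have S t : spline_sum delta 0 b.+2 L t 0 = \sum_(0 <= m < L) spline b.+2 (delta * m%:R + t).
  by apply: eq_bigr => m _; rewrite mulr0 addr0 cos0 mul1r.
rewrite -S spline_sum_window.
have s1 : s - 1 <= s by lra.
have := ge_Rintegral_itv (B := delta^-1 - 1) (bounded_measurable_spline_sum delta 0 b.+1 L 0) s1.
rewrite (_ : s - (s - 1) = 1); last lra.
rewrite mulr1; apply => t /andP[st ts].
rewrite /spline_sum.
under eq_bigr do rewrite mulr0 addr0 cos0 mul1r.
apply: IHb; first lra.
by move: sL; rewrite -(natr1 b.+1); lra.
Qed.

End SplineSums.

(** * Inequalities for sine and cosine *)

Section SineBounds.
Variable R : realType.
Implicit Types (a b x y z : R).

Lemma sin_mean_value a b : a <= b ->
  exists2 c, a <= c <= b & sin b - sin a = cos c * (b - a).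
Proof.
move=> ab; have [|c cab ->] := MVT_segment (f := @sin R) (df := @cos R) ab
  (fun x _ => is_derive_sin x).
  exact/continuous_subspaceT/continuous_sin.
by exists c => //; move: cab; rewrite in_itv.
Qed.

Lemma ler_cos x y : 0 <= x -> x <= y -> y <= pi -> cos y <= cos x.
Proof.
move=> x0; rewrite le_eqVlt => /predU1P[-> //|xy] ypi.
by apply: ltW; rewrite ltr_cos // in_itv /= ?x0 ?ypi ?andbT ?(le_trans _ ypi) ?(le_trans x0) ?ltW.
Qed.

Lemma mul_cos_le_sin z : 0 <= z <= pi -> z * cos z <= sin z.
Proof.
move=> /andP[z0 zpi]; have [c /andP[c0 cz]] := sin_mean_value z0.
rewrite sin0 !subr0 => ->; rewrite mulrC ler_wpM2r //.
exact: ler_cos.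
Qed.

Lemma sin_le_id z : 0 <= z -> sin z <= z.
Proof.
move=> z0; have [c _] := sin_mean_value z0.
rewrite sin0 !subr0 => ->; rewrite -[leRHS]mul1r ler_wpM2r //; exact: cos_le1.
Qed.

(** Concavity of the sine: its mean slope on [0, y] is at least that on
    [y, pi / 2]. *)
Lemma jordan_sin y : 0 <= y <= pi / 2 -> y <= pi / 2 * sin y.
Proof.
move=> /andP[y0 ypi]; have p0 := pi_gt0 R.
have [c /andP[c0 cy]] := sin_mean_value y0.
have [e /andP[ye epi]] := sin_mean_value ypi.
rewrite sin0 !subr0 sin_pihalf => h1 h2.
have ec : cos e <= cos c by apply: ler_cos => //; lra.
have : (1 - sin y) * y <= sin y * (pi / 2 - y).
  rewrite h1 h2 mulrAC -!mulrA [y * _]mulrC ler_wpM2r // mulr_ge0 //; lra.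
lra.
Qed.

(** With z = y / 2 the claim follows from z cos z <= sin z together with
    cos y = 2 cos z ^ 2 - 1 <= cos z ^ 4. *)
Lemma sqr_mul_cos_le_sin y : 0 <= y <= pi / 2 -> y ^+ 2 * cos y <= sin y ^+ 2.
Proof.
move=> /andP[y0 ypi]; have p0 := pi_gt0 R.
pose z := y / 2; have yz : y = z *+ 2 by rewrite /z mulr2n; lra.
have h : z * cos z <= sin z by apply: mul_cos_le_sin; rewrite /z; lra.
have z0 : 0 <= z by rewrite /z; lra.
have c0 : 0 <= cos z by apply: cos_ge0_pihalf; rewrite /z; lra.
rewrite yz cos_mulr2n sin_mulr2n; set C := cos z in h c0 *; set S := sin z in h *.
have h2 : (z * C ^+ 2) ^+ 2 <= (C * S) ^+ 2.
  by rewrite ler_sqr ?nnegrE; nra.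
have h3 : 2 * C ^+ 2 - 1 <= C ^+ 4 by have := sqr_ge0 (C ^+ 2 - 1); nra.
have h4 : z ^+ 2 * (2 * C ^+ 2 - 1) <= z ^+ 2 * C ^+ 4 by rewrite ler_wpM2l ?sqr_ge0.
lra.
Qed.

Lemma pi_sqr_ge8 : 8 <= pi ^+ 2 :> R.
Proof.
have p0 := pi_gt0 R.
have : cos (pi / 2) = 0 :> R := cos_pihalf R.
have -> : pi / 2 = (pi / 4) *+ 2 :> R by rewrite [RHS]mulr2n; lra.
rewrite cos_mulr2n cos2sin2 => h.
have s0 : 0 <= sin (pi / 4) :> R by apply: sin_ge0_pi; lra.
have s1 : sin (pi / 4) <= pi / 4 :> R by apply: sin_le_id; lra.
have : sin (pi / 4) ^+ 2 <= (pi / 4) ^+ 2 :> R by rewrite ler_sqr ?nnegrE //; lra.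
move: h; rewrite -mulr_natl; nra.
Qed.

(** Replacing |sin (pi x)| by 2 |x| alone would be too weak for the final
    constant. The cosine, which vanishes where Jordan's inequality is worst,
    pays for two of the factors and gains 4 / pi ^ 2 <= 1 / 2. *)
Lemma cos_sin_decay x n : `|x| <= 2^-1 ->
  (2 * `|x|) ^+ n.+2 * `|cos (pi * x)| <= 2^-1 * `|sin (pi * x)| ^+ n.+2.
Proof.
move=> hx; have p0 := pi_gt0 R.
have -> : `|cos (pi * x)| = cos (pi * `|x|).
  rewrite -(ger0_norm (cos_ge0_pihalf (x := pi * `|x|) _)); last first.
    by have := normr_ge0 x; nra.
  by case: (ger0P x) => //; rewrite mulrN cosN.
have -> : `|sin (pi * x)| = sin (pi * `|x|).
  rewrite -(ger0_norm (sin_ge0_pi (x := pi * `|x|) _)); last first.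
    by have := normr_ge0 x; nra.
  by case: (ger0P x) => //; rewrite mulrN sinN normrN.
have := normr_ge0 x; set w := `|x| in hx *; move=> w0.
set y := pi * w.
have hy : 0 <= y <= pi / 2 by rewrite /y; nra.
have c0 : 0 <= cos y by apply: cos_ge0_pihalf; lra.
have j : 2 * w <= sin y.
  have := jordan_sin hy; rewrite {1}/y; nra.
have h : (2 * w) ^+ 2 * cos y <= 2^-1 * sin y ^+ 2.
  have := sqr_mul_cos_le_sin hy; have := pi_sqr_ge8.
  have : 0 <= w ^+ 2 * cos y by rewrite mulr_ge0 ?sqr_ge0.
  rewrite {2}/y !exprMn; nra.
rewrite -(addn2 n) !exprD -mulrA [leRHS]mulrCA.
apply: ler_pM => //; first by rewrite exprn_ge0 // mulr_ge0.
- by rewrite mulr_ge0 // sqr_ge0.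
- by rewrite lerXn2r ?nnegrE //; lra.
Qed.

End SineBounds.

(** * Sums over separated points *)

Section SeparatedPoints.
Variable R : realType.
Implicit Types (x y z : R).

(** Telescoping, with 1 / k ^ 2 <= 1 / (k - 1/2) - 1 / (k + 1/2) for k >= 2. *)
Lemma sum_inv_sqr_le n : \sum_(1 <= k < n) (k%:R ^+ 2)^-1 <= 5 / 3 :> R.
Proof.
have [n1|n1] := leqP n 1; first by rewrite big_geq //; lra.
suff : \sum_(1 <= k < n) (k%:R ^+ 2)^-1 <= 5 / 3 - (n%:R - 2^-1)^-1 :> R.
  move=> /le_trans; apply; rewrite gerBl invr_ge0.
  have : 1 <= n%:R :> R by rewrite ler1n ltnW.
  lra.
elim: n n1 => // n IHn; rewrite ltnS leq_eqVlt => /predU1P[<-|n1].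
  by rewrite big_nat1 expr1n invr1 (_ : 2%:R - 2^-1 = 3 / 2) ?invf_div; lra.
rewrite big_nat_recr /=; last exact: ltnW.
apply: (le_trans (lerD (IHn n1) (lexx _))).
have n2 : 2 <= n%:R :> R by rewrite (ler_nat _ 2).
rewrite -(natr1 n); move: n%:R n2 => u n2 {IHn}.
have u0 : u ^+ 2 != 0 by rewrite expf_neq0 //; lra.
have u1 : u - 2^-1 != 0 by lra.
have u2 : u + 1 - 2^-1 != 0 by lra.
have -> : (u - 2^-1)^-1 = (u + 1 - 2^-1)^-1 + ((u - 2^-1) * (u + 1 - 2^-1))^-1.
  by field; apply/andP; split; lra.
suff : (u ^+ 2)^-1 <= ((u - 2^-1) * (u + 1 - 2^-1))^-1 by lra.
rewrite lef_pV2 ?posrE; nra.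
Qed.

Lemma expnS_sub_le k d : (0 < k)%N ->
  (k.+1 ^ d.+1 - k ^ d.+1 <= (2 ^ d.+1 - 1) * k ^ d)%N.
Proof.
move=> k0; rewrite leq_subLR.
elim: d => [|d IHd]; first by rewrite !expn1 expn0; lia.
have kk : (k ^ d <= k ^ d.+1)%N by rewrite expnS leq_pmull.
have e2 : (1 <= 2 ^ d.+1)%N by rewrite expn_gt0.
rewrite (expnS k.+1) (expnS 2) (expnS k d.+1).
have := leq_mul (leqnn k.+1) IHd.
move/leq_trans; apply.
move: kk e2 (expnS k d).
move: (k ^ d.+1)%N (k ^ d)%N (2 ^ d.+1)%N => a b c kk e2 ab.
nia.
Qed.

Lemma card_ffun_bounded d n k : (k <= n)%N ->
  #|[set f : {ffun 'I_d -> bool * 'I_n} | [forall t, (f t).2 < k]%N]| =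
  ((2 * k) ^ d)%N.
Proof.
move=> kn; pose A := [set p : bool * 'I_n | (p.2 < k)%N].
have -> : [set f : {ffun 'I_d -> bool * 'I_n} | [forall t, (f t).2 < k]%N] =
    [set f in ffun_on (mem A)].
  apply/setP => f; rewrite !inE; apply/forallP/ffun_onP => h t.
    by have := h t; rewrite inE.
  by have := h t; rewrite inE.
rewrite cardsE card_ffun_on card_ord; congr (_ ^ _)%N.
have -> : A = finset.setX [set: bool] [set i : 'I_n | (i < k)%N].
  by apply/setP => -[b i]; rewrite !inE.
rewrite cardsX cardsT card_bool; congr (_ * _)%N.
by rewrite -sum1dep_card -(big_ord_widen n (fun=> 1%N)) // sum1_card card_ord.
Qed.

Lemma mx_coord_le_norm d (v : 'rV[R]_d) t : `|v 0 t| <= `|v|.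
Proof.
rewrite [leRHS]/Num.Def.normr /= mx_normrE.
exact: (le_bigmax _ (fun p => `|v p.1 p.2|) (0, t)).
Qed.

Lemma mx_norm_lt d (v : 'rV[R]_d) z : 0 < z ->
  (forall t, `|v 0 t| < z) -> `|v| < z.
Proof.
move=> z0 hv; rewrite [ltLHS]/Num.Def.normr /= mx_normrE.
by apply: bigmax_lt => // -[i t] _ /=; rewrite (ord1 i).
Qed.

Lemma mx_norm_attained d (v : 'rV[R]_d) : 0 < `|v| ->
  exists t, `|v 0 t| = `|v|.
Proof.
move=> v0; have /mx_norm_neq0 [[i t] e] : mx_norm v != 0 by rewrite gt_eqF.
by exists t; rewrite [RHS]/Num.Def.normr /= e /= (ord1 i).
Qed.

Section Shells.
Variables (I : finType) (P : pred I) (d : nat) (y : I -> 'rV[R]_d) (q : R).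
Hypothesis q0 : 0 < q.
Hypothesis y_far : forall l, P l -> q <= `|y l|.
Hypothesis y_sep : forall l l', P l -> P l' -> l != l' -> q <= `|y l - y l'|.

Let cell (u : R) := Num.truncn (`|u| / q).
Let shell l := Num.truncn (`|y l| / q).
Let n := (\max_l shell l).+1.

Let shell_lt l : (shell l < n)%N.
Proof. by rewrite ltnS; exact: (leq_bigmax l). Qed.

Let cell_le_shell l t : (cell (y l 0%R t) <= shell l)%N.
Proof. by apply: le_truncn; rewrite ler_pM2r ?invr_gt0 // mx_coord_le_norm. Qed.

Let cell_lt l t : (cell (y l 0%R t) < n)%N.
Proof. exact: leq_ltn_trans (cell_le_shell l t) (shell_lt l). Qed.

Let code l : {ffun 'I_d -> bool * 'I_n} :=
  [ffun t => (y l 0 t < 0, Ordinal (cell_lt l t))].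

Lemma same_cell u v : (u < 0) = (v < 0) -> cell u = cell v -> `|u - v| < q.
Proof.
move=> suv; rewrite /cell => cuv.
have tn z : (Num.truncn (`|z| / q))%:R * q <= `|z| < (Num.truncn (`|z| / q)).+1%:R * q.
  have := truncn_itv (divr_ge0 (normr_ge0 z) (ltW q0)).
  by rewrite ler_pdivlMr // ltr_pdivrMr.
have := tn u; have := tn v; rewrite cuv -natr1 mulrDl mul1r.
move: suv; case: (ltrP u 0) => hu; case: (ltrP v 0) => // hv _.
  rewrite (ltr0_norm hu) (ltr0_norm hv) ltr_norml; lra.
rewrite (ger0_norm hu) (ger0_norm hv) ltr_norml; lra.
Qed.

Let code_inj : {in P &, injective code}.
Proof.
move=> l l' Pl Pl' ell; apply/eqP; apply: contraT => ll.
have := y_sep Pl Pl' ll; rewrite leNgt => /negP[]; apply: mx_norm_lt => // t.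
have := congr1 (fun f : {ffun 'I_d -> bool * 'I_n} => f t) ell.
by rewrite !ffunE !mxE => -[h1 h2]; apply: same_cell.
Qed.

(** A point is coded by the signs of its coordinates and by the integer parts of
    their absolute values divided by q. Points with the same code have distance
    less than q, so the code is injective, and the largest integer part is the
    number of the shell. Coding by signs, and not by the floor of the
    coordinates, keeps a coordinate equal to -q out of the innermost cells. *)
Lemma card_shell k : (k < n)%N ->
  (#|[set l | P l & shell l == k]| <= 2 ^ d * (k.+1 ^ d - k ^ d))%N.
Proof.
move=> kn.
pose S j := [set f : {ffun 'I_d -> bool * 'I_n} | [forall t, (f t).2 < j]%N].
have -> : (2 ^ d * (k.+1 ^ d - k ^ d) = #|S k.+1 :\: S k|)%N.
  have sub : S k \subset S k.+1.
    apply/fintype.subsetP => f; rewrite !inE => /forallP h; apply/forallP => t.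
    exact: leqW.
  by rewrite cardsDS // !card_ffun_bounded ?(ltnW kn) // !expnMn mulnBr.
rewrite -(card_in_imset (f := code)); last first.
  by move=> l l'; rewrite !inE => /andP[Pl _] /andP[Pl' _]; exact: code_inj.
apply/subset_leq_card/fintype.subsetP => f /imsetP[l].
rewrite inE => /andP[Pl /eqP sl] ->; rewrite !inE; apply/andP; split.
  have [t et] := mx_norm_attained (lt_le_trans q0 (y_far Pl)).
  apply/negP => /forallP /(_ t); rewrite ffunE /= /cell et -/(shell l) sl.
  by rewrite ltnn.
by apply/forallP => t; rewrite ffunE /= ltnS -sl; exact: cell_le_shell.
Qed.

(** Summation over shells: the shell number k contributes at most
    2 ^ d (2 ^ d - 1) k ^ (d - 1) points, each with a term at most
    k ^ - (d + 1), and the innermost shell is empty. *)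
Lemma sum_separated_le : (0 < d)%N ->
  \sum_(l | P l) (q / `|y l|) ^+ d.+1 <= (2 ^ d * (2 ^ d - 1))%:R * (5 / 3).
Proof.
move=> d0.
have le1 : \sum_(l | P l) (q / `|y l|) ^+ d.+1 <=
    \sum_(l | P l) ((shell l)%:R ^+ d.+1)^-1.
  apply: ler_sum => l Pl; have yl := y_far Pl.
  have y0 : 0 < `|y l| := lt_le_trans q0 yl.
  have s0 : 0 < (shell l)%:R :> R.
    by rewrite ltr0n truncn_gt0 ler_pdivlMr // mul1r.
  rewrite -exprVn.
  apply: lerXn2r; rewrite ?nnegrE ?divr_ge0 ?invr_ge0 ?(ltW y0) ?(ltW q0) ?(ltW s0) //.
  rewrite -[leLHS]invf_div lef_pV2 ?posrE ?divr_gt0 //.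
  by have /andP[] := truncn_itv (divr_ge0 (ltW y0) (ltW q0)).
apply: (le_trans le1).
rewrite (partition_big (fun l => Ordinal (shell_lt l)) predT) //=.
have le2 (k : 'I_n) : \sum_(l | P l && (Ordinal (shell_lt l) == k))
     ((shell l)%:R ^+ d.+1)^-1 <=
   (if (0 < k)%N then (2 ^ d * (2 ^ d - 1))%:R * (k%:R ^+ 2)^-1 else 0 : R).
  rewrite (eq_bigr (fun=> (k%:R ^+ d.+1)^-1)); last first.
    by move=> l /andP[_ /eqP <-].
  rewrite sumr_const.
  have -> : #|(fun l => P l && (Ordinal (shell_lt l) == k))| =
     #|[set l | P l & shell l == k]| by apply: eq_card => l; rewrite !inE.
  case: ifP => [k0|/negbT]; last first.
    rewrite -eqn0Ngt => /eqP ->; rewrite [#|_|](_ : _ = 0%N) ?mulr0n //.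
    apply/eqP; rewrite cards_eq0; apply/eqP/setP => l; rewrite !inE.
    apply/negbTE/negP => /andP[Pl]; apply/negP; rewrite -lt0n truncn_gt0.
    by rewrite ler_pdivlMr // mul1r y_far.
  have kR : 0 < k%:R :> R by rewrite ltr0n.
  rewrite -[leLHS]mulr_natr [leLHS]mulrC.
  have h : (#|[set l | P l & shell l == k]| <= 2 ^ d * ((2 ^ d - 1) * k ^ d.-1))%N.
    apply: leq_trans (card_shell (ltn_ord k)) _; rewrite leq_pmul2l ?expn_gt0 //.
    by rewrite -{1 2 3}(prednK d0); exact: expnS_sub_le.
  rewrite ler_pdivrMr ?exprn_gt0 //.
  rewrite -(ler_nat R) in h; apply: (le_trans h).
  have e : (k%:R ^+ 2)^-1 * k%:R ^+ d.+1 = k%:R ^+ d.-1 :> R.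
    rewrite -{1}(prednK d0) -(addn2 d.-1) exprD mulrC mulfK //.
    by rewrite expf_neq0 // gt_eqF.
  by rewrite -mulrA e mulnA natrM natrX.
apply: (le_trans (ler_sum _ (fun k _ => le2 k))).
rewrite -big_mkcond /= -mulr_sumr ler_wpM2l ?ler0n //.
apply: le_trans (sum_inv_sqr_le n).
by rewrite (big_nat_widenl 1 0) // big_mkord.
Qed.

End Shells.
End SeparatedPoints.

(** * Hermitian matrices near the identity *)

Section NearIdentity.
Variable R : realType.
Variables (M : nat) (K : 'M[R[i]]_M) (rho : R).
Local Open Scope complex_scope.

Hypothesis K_herm : K = K^t*%sesqui.
Hypothesis K_diag : forall j, K j j = 1.
Hypothesis K_rows : forall j, \sum_(l | l != j) `|K j l| <= rho%:C.

Let sp := spectral_diag K.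
Let mu i := complex.Re (sp 0 i).

Let K_hermsym : K \is hermsymmx.
Proof. by apply/is_hermitianmxP; rewrite expr0 scale1r. Qed.

Let K_spectral : K = invmx (spectralmx K) *m diag_mx sp *m spectralmx K.
Proof. exact/orthomx_spectralP/hermitian_normalmx. Qed.

Let sp_real i : sp 0 i = (mu i)%:C.
Proof.
have /mxOverP /(_ 0 i) := hermitian_spectral_diag_real K_hermsym.
by move=> h; rewrite /mu RRe_real.
Qed.

(** The diagonal of the unitary diagonalisation lists the whole spectrum, which
    also makes the trace available as the sum of the eigenvalues. *)
Let spectrumE a : (spectrum K) a <-> exists i, a = (mu i)%:C.
Proof.
have Pu := spectral_unit K.
split.
  move=> /eigenvalueP[v vK v0].
  pose w := v *m invmx (spectralmx K).
  have w0 : w != 0.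
    apply: contra_neq v0 => w0; rewrite -[v](mulmxKV Pu) -/w w0 mul0mx //.
  have wD : w *m diag_mx sp = a *: w.
    rewrite /w scalemxAl -vK [in v *m K]K_spectral !mulmxA.
    by rewrite mulmxK.
  move: w w0 wD => w w0 wD; have /rV0Pn[i wi] := w0.
  exists i; have := congr1 (fun u : 'rV_M => u 0 i) wD.
  by rewrite mul_mx_diag !mxE [LHS]mulrC sp_real => e; rewrite -(mulIf wi e).
move=> [i ->]; apply/eigenvalueP.
pose e : 'rV[R[i]]_M := delta_mx 0 i.
exists (e *m spectralmx K).
  have -> : e *m spectralmx K *m K =
      e *m (diag_mx sp *m spectralmx K).
    by rewrite -mulmxA {2}K_spectral !mulmxA mulmxK.
  rewrite mulmxA.
  rewrite scalemxAl -sp_real; congr (_ *m _).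
  apply/rowP => j; rewrite mul_mx_diag !mxE eqxx /=.
  by case: eqVneq => [->|_]; rewrite ?mul1r ?mulr1 ?mul0r ?mulr0.
apply/negP => /eqP h; have : e = 0.
  by rewrite -[LHS](mulmxK Pu) h mul0mx.
by move/rowP/(_ i); rewrite !mxE !eqxx => /eqP; rewrite oner_eq0.
Qed.

Let sum_mu : \sum_i mu i = M%:R.
Proof.
have : \tr K = \sum_i (mu i)%:C.
  rewrite K_spectral mxtrace_mulC mulmxA mulmxV ?spectral_unit // mul1mx.
  by rewrite mxtrace_diag; apply: eq_bigr => i _; exact: sp_real.
rewrite /mxtrace (eq_bigr (fun=> 1)) // sumr_const card_ord.
rewrite -rmorph_sum => /(congr1 (@complex.Re R)) /= <-.
by rewrite -(rmorph_nat (real_complex R)).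
Qed.

(** Gershgorin's argument at the largest coordinate of an eigenvector. *)
Let mu_close i : `|mu i - 1| <= rho.
Proof.
have /eigenvalueP[v vK v0] : (spectrum K) (mu i)%:C by apply/spectrumE; exists i.
have /rV0Pn[j0 _] := v0.
pose c j := complex.Re `|v 0 j|.
have cE j : `|v 0 j| = (c j)%:C by rewrite /c RRe_real // normr_real.
pose j := [arg max_(j > j0) c j]%O.
have jmax l : c l <= c j.
  by rewrite /j; case: arg_maxP => // k _ h; apply: h.
have cj0 : 0 < (c j)%:C.
  have /rV0Pn[k vk] := v0.
  rewrite (lt_le_trans (_ : 0 < (c k)%:C)) ?lecR //.
  by rewrite -cE normr_gt0.
have h : v 0 j * ((mu i)%:C - 1) = \sum_(l | l != j) v 0 l * K l j.
  have := congr1 (fun u : 'rV_M => u 0 j) vK; rewrite !mxE (bigD1 j) //= K_diag.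
  by rewrite mulrBr mulr1 [_%:C * _]mulrC => <-; rewrite addrC addrK.
suff : `|((mu i)%:C - 1 : R[i])| <= rho%:C.
  by rewrite -(rmorph1 (real_complex R)) -rmorphB normc_def /= expr0n addr0 sqrtr_sqr lecR.
rewrite -(ler_pM2l cj0) -cE -normrM h.
apply: (le_trans (ler_norm_sum _ _ _)).
apply: (le_trans (y := \sum_(l | l != j) `|v 0 j| * `|K j l|)).
  apply: ler_sum => l _; rewrite normrM [in X in X * _]cE [in X in _ <= X * _]cE.
  have -> : `|K l j| = `|K j l|.
    by rewrite [in LHS]K_herm !mxE norm_conjC.
  by rewrite ler_wpM2r // lecR.
by rewrite -mulr_sumr ler_wpM2l.
Qed.

(** The outer bounds are Gershgorin's; the bounds by 1 hold because the
    eigenvalues have mean 1, the trace being M. *)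
Lemma near_identity_eigenvalues : (0 < M)%N -> exists lambda Lambda : R,
  [/\ smallest_eigenvalue K lambda, largest_eigenvalue K Lambda,
      1 - rho <= lambda <= 1 & 1 <= Lambda <= 1 + rho].
Proof.
move=> M0; pose i0 := Ordinal M0.
have MR : 0 < M%:R :> R by rewrite ltr0n.
pose a := [arg min_(i < i0) mu i]%O; pose b := [arg max_(i > i0) mu i]%O.
have amin i : mu a <= mu i by rewrite /a; case: arg_minP => // k _ h; apply: h.
have bmax i : mu i <= mu b by rewrite /b; case: arg_maxP => // k _ h; apply: h.
have mean r : r * M%:R = \sum_(i < M) r.
  by rewrite sumr_const card_ord mulr_natr.
exists (mu a), (mu b); split.
- split; first by apply/spectrumE; exists a.
  by move=> _ /spectrumE[i ->]; rewrite lecR.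
- split; first by apply/spectrumE; exists b.
  by move=> _ /spectrumE[i ->]; rewrite lecR.
- have := mu_close a; rewrite ler_norml => /andP[h _].
  apply/andP; split; first lra.
  rewrite -(ler_pM2r MR) mul1r -{2}sum_mu mean.
  exact: ler_sum.
- have := mu_close b; rewrite ler_norml => /andP[_ h].
  apply/andP; split; last lra.
  rewrite -(ler_pM2r MR) mul1r -{1}sum_mu mean.
  exact: ler_sum.
Qed.

End NearIdentity.

Lemma row_free_smallest_eigenvalue_gt0 (R : realType) (M : nat) (K : 'M[R[i]]_M)
    (lambda : R) : smallest_eigenvalue K lambda -> 0 < lambda -> row_free K.
Proof.
move=> [_ lb] l0; rewrite -kermx_eq0; apply/eqP/eqP/negPn/negP => k0.
have := lb 0; rewrite /spectrum /= /eigenvalue /eigenspace raddf0 subr0 => /(_ k0).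
by rewrite -(rmorph0 (real_complex R)) lecR leNgt l0.
Qed.

(** * The complex exponential *)

Section Exponential.
Variable R : realType.
Implicit Types (x y : R).
Local Open Scope complex_scope.

Lemma e2piD x y : e2pi (x + y) = e2pi x * e2pi y :> R[i].
Proof.
by apply/eqP; rewrite eq_complex /= !mulrDr cosD sinD addrC [X in _ && (X == _)]addrC !eqxx /=
  ?[_ * cos _]mulrC.
Qed.

Lemma e2pi0 : e2pi 0 = 1 :> R[i].
Proof. by rewrite /e2pi !mulr0 cos0 sin0. Qed.

Lemma norm_e2pi x : `|e2pi x| = 1 :> R[i].
Proof. by rewrite normc_def /= cos2Dsin2 sqrtr1. Qed.

Lemma e2piN x : e2pi (- x) = (e2pi x)^-1.
Proof.
have e0 : e2pi x != 0 by rewrite -normr_eq0 norm_e2pi oner_eq0.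
by apply: (mulIf e0); rewrite mulVf // -e2piD addNr e2pi0.
Qed.

Lemma conj_e2pi x : (e2pi x : R[i])^*%R = e2pi (- x).
Proof.
have e0 : e2pi x != 0 by rewrite -normr_eq0 norm_e2pi oner_eq0.
by apply: (mulfI e0); rewrite -normCK norm_e2pi -e2piD subrr e2pi0 expr1n.
Qed.

Lemma e2pi_sum (I : Type) (r : seq I) (P : pred I) (F : I -> R) :
  e2pi (\sum_(i <- r | P i) F i) = \prod_(i <- r | P i) e2pi (F i).
Proof. exact: (big_morph _ e2piD e2pi0). Qed.

Lemma e2pi_int (m : int) : e2pi (m%:~R) = 1 :> R[i].
Proof.
have h n : e2pi (n%:R : R) = 1.
  elim: n => [|n IHn]; first exact: e2pi0.
  rewrite -natr1 e2piD IHn mul1r /e2pi mulr1 mulr_natl.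
  by rewrite cos2pi sin2pi.
by case: m => n; rewrite ?NegzE ?mulrNz ?e2piN h ?invr1.
Qed.

Lemma e2pi1D x : 1 + e2pi (- x) = e2pi (- x / 2) * (2 * cos (pi * x))%:C.
Proof.
rewrite -e2pi0 (_ : 0 = - x / 2 + x / 2); last lra.
rewrite {2}(_ : - x = - x / 2 + (- (x / 2))); last lra.
rewrite !e2piD -mulrDr; congr (_ * _).
rewrite /e2pi mulrN cosN sinN (_ : 2 * pi * (x / 2) = pi * x); last lra.
by apply/eqP; rewrite eq_complex /= subrr eqxx andbT; apply/eqP; lra.
Qed.

Lemma norm_e2pi1D x : `|1 + e2pi (- x)| = (2 * `|cos (pi * x)|)%:C.
Proof.
rewrite e2pi1D normrM norm_e2pi mul1r normc_def /= expr0n addr0 sqrtr_sqr.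
by rewrite normrM (@ger0_norm _ 2).
Qed.

Lemma angle_of_unit (u v : R) : u ^+ 2 + v ^+ 2 = 1 ->
  exists theta, cos theta = u /\ sin theta = v.
Proof.
move=> uv.
have u1 : -1 <= u <= 1 by have v2 := sqr_ge0 v; apply/andP; split; nra.
have s2 : sin (acos u) ^+ 2 = v ^+ 2.
  by rewrite sin2cos2 acosK ?in_itv //; lra.
have /orP[/eqP s|/eqP s] : (sin (acos u) == v) || (sin (acos u) == - v).
  by rewrite -eqf_sqr s2.
- by exists (acos u); rewrite acosK ?in_itv.
- by exists (- acos u); rewrite cosN sinN acosK ?in_itv // s opprK.
Qed.

(** The modulus of a complex number is its largest real part over all rotations. *)
Lemma norm_trig_sum_le (n : nat) (r : nat -> R) x B :
  (forall theta, \sum_(0 <= m < n) cos (m%:R * (2 * pi * x) + theta) * r m <= B) ->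
  `|\sum_(0 <= m < n) (r m)%:C * e2pi (m%:R * x)| <= B%:C.
Proof.
move=> hB.
set u := \sum_(0 <= m < n) cos (m%:R * (2 * pi * x)) * r m.
set v := \sum_(0 <= m < n) sin (m%:R * (2 * pi * x)) * r m.
have -> : \sum_(0 <= m < n) (r m)%:C * e2pi (m%:R * x) = u +i* v.
  rewrite [RHS]complexE /= !rmorph_sum mulr_sumr -big_split /=.
  apply: eq_bigr => m _.
  apply/eqP; rewrite eq_complex /=; apply/andP; split; apply/eqP;
    rewrite (_ : 2 * pi * (m%:R * x) = m%:R * (2 * pi * x)); ring.
have rot theta : \sum_(0 <= m < n) cos (m%:R * (2 * pi * x) + theta) * r m =
    cos theta * u - sin theta * v.
  by rewrite !mulr_sumr -sumrB; apply: eq_bigr => m _; rewrite cosD; ring.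
rewrite normc_def /= lecR.
set rho := Num.sqrt _.
have rho2 : rho ^+ 2 = u ^+ 2 + v ^+ 2 by rewrite sqr_sqrtr // addr_ge0 // sqr_ge0.
have [->|rho0] := eqVneq rho 0.
  have := hB 0; have := hB pi; rewrite !rot cospi sinpi cos0 sin0; lra.
have [|theta [ct st]] := @angle_of_unit (u / rho) (- v / rho).
  by rewrite !exprMn sqrrN -mulrDl -rho2 -exprMn divff // expr1n.
have := hB theta; rewrite rot ct st.
suff -> : u / rho * u - - v / rho * v = rho by [].
by rewrite -[RHS](mulfK rho0) -expr2 rho2; field.
Qed.

End Exponential.

(** * The univariate B-spline kernel *)

Section KernelDecay.
Variable R : realType.
Local Open Scope complex_scope.
Variables (b N : nat).
Implicit Types x theta : R.
Hypotheses (N0 : (0 < N)%N) (N_even : ~~ odd N).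

Local Notation beta := b.+2.
Local Notation spline := (@cardinal_bspline R).
Local Notation g m := (normalised_bspline beta ((centered N m)%:~R / N%:R) : R).
Local Notation delta := (beta%:R / N%:R : R).
Local Notation nrm := (bspline_norm1 R beta N).

Let NR : 0 < N%:R :> R. Proof. by rewrite ltr0n. Qed.
Let d0 : 0 < delta. Proof. by rewrite divr_gt0 // ltr0n. Qed.

Lemma centered_half m : (centered N m)%:~R = m%:R - N%:R / 2 :> R.
Proof.
have e : (N./2)%:R = N%:R / 2 :> R.
  have := odd_double_half N; rewrite (negbTE N_even) add0n => {2}<-.
  by rewrite -mul2n natrM [2%:R * _]mulrC mulfK.
by rewrite /centered rmorphB /= -!pmulrn e.
Qed.

Lemma normalised_bspline_grid m : g m = beta%:R * spline beta (delta * m%:R).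
Proof.
rewrite /normalised_bspline centered_half; congr (_ * spline _ _).
by field; rewrite gt_eqF.
Qed.

Lemma bspline_norm1_grid :
  nrm = beta%:R * \sum_(0 <= m < N.+1) spline beta (delta * m%:R).
Proof.
by rewrite /bspline_norm1 mulr_sumr; apply: eq_bigr => m _; rewrite normalised_bspline_grid.
Qed.

Lemma bspline_norm1_ge : beta%:R * (delta^-1 - 1) <= nrm.
Proof.
rewrite bspline_norm1_grid ler_wpM2l //.
have := @spline_sum_ge R delta b.+1 N.+1 0 d0 (lexx _).
rewrite addr0 -(natr1 N) mulrDr mulr1 mulfVK ?gt_eqF // lerDl (ltW d0) => /(_ isT).
by under eq_bigr do rewrite addr0.
Qed.

Lemma bspline_norm1_gt0 : delta < 1 -> 0 < nrm.
Proof.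
move=> d1; apply: lt_le_trans bspline_norm1_ge.
by rewrite mulr_gt0 ?ltr0n // subr_gt0 invf_gt1.
Qed.

(** The grid is extended by indices where the spline vanishes, which provides
    the margins on both sides that the recursion consumes. *)
Lemma trig_spline_sum_decay x theta : sin (pi * x) != 0 ->
  `|\sum_(0 <= m < N.+1) cos (m%:R * (2 * pi * x) + theta) * spline beta (delta * m%:R)| <=
  delta ^+ b.+1 / `|sin (pi * x)| ^+ beta.
Proof.
set phi := 2 * pi * x => S0.
have hphi : phi / 2 = pi * x by rewrite /phi; lra.
(* K vanishing terms before the grid and N after it. *)
pose K := b.+1; pose L := (K + (N.+1 + N))%N.
pose s := - (K%:R * delta).
have := @spline_sum_decay R delta phi b.+1 L s (theta - K%:R * phi) d0.
rewrite hphi => /(_ S0); rewrite /s addNr lexx => /(_ isT).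
have -> : 2 * b.+1%:R <= delta * L%:R - K%:R * delta.
  rewrite /L !natrD -(natr1 N).
  have -> : delta * (K%:R + (N%:R + 1 + N%:R)) - K%:R * delta =
     2 * beta%:R + delta by field; rewrite gt_eqF.
  have : b.+1%:R <= beta%:R :> R by rewrite ler_nat.
  by have := d0; lra.
move=> /(_ isT).
suff -> : spline_sum delta phi beta L (- (K%:R * delta)) (theta - K%:R * phi) =
   \sum_(0 <= m < N.+1) cos (m%:R * phi + theta) * spline beta (delta * m%:R) by [].
have cat (F : nat -> R) j k : \sum_(0 <= m < j + k) F m =
    \sum_(0 <= m < j) F m + \sum_(0 <= m < k) F (m + j)%N.
  by rewrite (big_cat_nat (n := j)) ?leq_addr //= -{2}[j]add0n big_addn addKn.
rewrite /spline_sum /L !cat big_nat_cond big1 ?add0r; last first.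
  move=> m; rewrite andbT => /andP[_ mK]; rewrite cardinal_bspline_eq0 ?mulr0 //.
  by rewrite mulrC -mulrBl pmulr_lle0 // subr_le0 ler_nat ltnW.
rewrite [X in _ + X = _]big_nat_cond [X in _ + X = _]big1 ?addr0; last first.
  move=> m _; rewrite cardinal_bspline_eq0 ?mulr0 //.
  apply/orP; right; rewrite natrD [delta * _]mulrC mulrDl addrK.
  by rewrite mulrA ler_pdivlMr // [leLHS]mulrC ler_wpM2r // ler_nat -addSnnS leq_addl.
by apply: eq_bigr => m _; rewrite natrD; congr (cos _ * spline _ _); lra.
Qed.

Lemma grid_sum_factor x :
  \sum_(0 <= m < N.+1) (g m)%:C * e2pi ((centered N m)%:~R * x) =
  e2pi (- (N%:R / 2) * x) * (beta%:R%:C *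
    \sum_(0 <= m < N.+1) (spline beta (delta * m%:R))%:C * e2pi (m%:R * x)).
Proof.
rewrite !mulr_sumr; apply: eq_bigr => m _.
rewrite normalised_bspline_grid centered_half mulrBl -mulNr e2piD rmorphM /=; ring.
Qed.

Lemma norm_bspline_kernel1 x : delta < 1 ->
  `|bspline_kernel1 beta N x| * (nrm)%:C =
  `|cos (pi * x)|%:C * (beta%:R%:C *
    `|\sum_(0 <= m < N.+1) (spline beta (delta * m%:R))%:C * e2pi (m%:R * x)|).
Proof.
move=> d1; have n0 := bspline_norm1_gt0 d1.
rewrite /bspline_kernel1 grid_sum_factor !normrM normfV norm_e2pi1D norm_e2pi !normrM.
have -> : `|beta%:R%:C : R[i]| = beta%:R%:C by rewrite ger0_norm // ler0c.
have -> : `|nrm%:C : R[i]| = nrm%:C by rewrite ger0_norm // ler0c ltW.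
have nC : nrm%:C != 0 by rewrite gt_eqF // (ltcR 0).
rewrite normr_nat [(2 * _)%:C]rmorphM rmorph_nat.
move: `|\sum_(_ <= _ < _) _| (nrm%:C) nC => z n nC.
by field.
Qed.

Lemma norm_bspline_kernel1_le1 x : delta < 1 -> `|bspline_kernel1 beta N x| <= 1 :> R[i].
Proof.
move=> d1; have n0 := bspline_norm1_gt0 d1.
have nC : 0 < nrm%:C :> R[i] by rewrite (ltcR 0).
rewrite -(ler_pM2r nC) norm_bspline_kernel1 // mul1r bspline_norm1_grid rmorphM.
rewrite -[leRHS]mul1r; apply: ler_pM.
- by rewrite ler0c.
- apply: mulr_ge0; first by rewrite ler0c. exact: normr_ge0.
- by rewrite -[leRHS](rmorph1 (real_complex R)) lecR cos_max.
rewrite ler_wpM2l ?ler0c //; apply: (le_trans (ler_norm_sum _ _ _)).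
rewrite rmorph_sum; apply: ler_sum => m _.
by rewrite normrM norm_e2pi mulr1 ger0_norm // ler0c cardinal_bspline_ge0.
Qed.

(** Quotient of the decay of the exponential sum by the lower bound of its value
    at 0; the prefactor (1 + exp (-2 pi i x)) / 2 has modulus |cos (pi x)|. *)
Lemma norm_bspline_kernel1_decay x : delta < 1 -> x != 0 -> `|x| <= 2^-1 ->
  `|bspline_kernel1 beta N x| <=
    ((2 * (1 - delta))^-1 * (delta / (2 * `|x|)) ^+ beta)%:C.
Proof.
move=> d1 x0 xh; have n0 := bspline_norm1_gt0 d1.
have ax : 0 < `|x| by rewrite normr_gt0.
have p0 := pi_gt0 R.
have S0 : sin (pi * x) != 0.
  have : 0 < sin (pi * `|x|) by apply: sin_gt0_pi; nra.
  by case: (ger0P x) => _; rewrite ?mulrN ?sinN ?oppr_gt0 => h; [rewrite gt_eqF|rewrite lt_eqF].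
have nC : 0 < nrm%:C :> R[i] by rewrite (ltcR 0).
rewrite -(ler_pM2r nC) norm_bspline_kernel1 //.
have hs := @norm_trig_sum_le R N.+1 (fun m => spline beta (delta * m%:R)) x _
  (fun theta => le_trans (ler_norm _) (trig_spline_sum_decay theta S0)).
apply: (le_trans (y := `|cos (pi * x)|%:C * (beta%:R%:C *
   (delta ^+ b.+1 / `|sin (pi * x)| ^+ beta)%:C))).
  by rewrite !ler_wpM2l ?ler0c.
rewrite -!rmorphM lecR.
apply: (le_trans (y := (2 * (1 - delta))^-1 * (delta / (2 * `|x|)) ^+ beta *
   (beta%:R * (delta^-1 - 1)))); last first.
  rewrite ler_wpM2l ?bspline_norm1_ge // mulr_ge0 ?invr_ge0 ?exprn_ge0 ?divr_ge0 ?mulr_ge0 //.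
  by rewrite subr_ge0 ltW.
have := cos_sin_decay b xh; set c := `|cos _|; set S := `|sin _|; set w := 2 * `|x| => h.
have Sp : 0 < S by rewrite normr_gt0.
have w0 : 0 < w by rewrite mulr_gt0.
have e1 : (2 * (1 - delta))^-1 * (delta / w) ^+ beta * (beta%:R * (delta^-1 - 1)) =
    beta%:R * delta ^+ b.+1 * (2^-1 / w ^+ beta).
  have D1 : 1 - delta != 0 by rewrite subr_eq0 gt_eqF.
  move: D1 (gt_eqF d0) => D1 D0.
  rewrite expr_div_n (exprS delta b.+1); move: (delta ^+ b.+1) => t.
  move: delta D1 D0 => D D1 D0.
  by field; rewrite D0 D1 !andbT expf_neq0 // gt_eqF.
have e2 : c * (beta%:R * (delta ^+ b.+1 / S ^+ beta)) = beta%:R * delta ^+ b.+1 * (c / S ^+ beta).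
  by ring.
rewrite e1 e2 ler_wpM2l //.
by rewrite ler_pdivrMr ?exprn_gt0 // mulrAC ler_pdivlMr ?exprn_gt0 // mulrC.
Qed.

Lemma bspline_kernel1_int x (m : int) :
  bspline_kernel1 beta N (x + m%:~R) = bspline_kernel1 beta N x.
Proof.
rewrite /bspline_kernel1 opprD e2piD -mulrNz e2pi_int mulr1; congr (_ * _).
apply: eq_bigr => k _; rewrite mulrDr e2piD.
by rewrite -intrM e2pi_int mulr1.
Qed.

Lemma bspline_kernel1_0 : delta < 1 -> bspline_kernel1 beta N 0 = 1 :> R[i].
Proof.
move=> d1; have n0 := bspline_norm1_gt0 d1.
rewrite /bspline_kernel1 oppr0 e2pi0.
under eq_bigr do rewrite mulr0 e2pi0 mulr1.
rewrite -rmorph_sum -/nrm.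
have nC : nrm%:C != 0 by rewrite gt_eqF // (ltcR 0).
by field.
Qed.

(** The prefactor averages neighbouring coefficients. The end coefficients
    g (-1/2) and g (1/2) vanish since the order is at least two, which leaves
    exactly N frequencies. *)
Lemma bspline_kernel1_fourier x :
  bspline_kernel1 beta N x =
  \sum_(m < N) ((normalised_bspline beta ((centered N m)%:~R / N%:R) +
       normalised_bspline beta ((centered N m + 1)%:~R / N%:R)) / (2 * nrm))%:C *
     e2pi ((centered N m)%:~R * x).
Proof.
have g0 : g 0 = 0.
  by rewrite normalised_bspline_grid mulr0 cardinal_bspline_eq0 ?mulr0 // lexx.
have gN : g N = 0.
  rewrite normalised_bspline_grid cardinal_bspline_eq0 ?mulr0 //.
  by rewrite mulfVK ?gt_eqF // lexx orbT.
have cS m : centered N m + 1 = centered N m.+1 by rewrite /centered; lia.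
rewrite /bspline_kernel1 mulrAC mulrDl mul1r.
rewrite {1}big_nat_recr //= gN mul0r addr0.
rewrite big_nat_recl //= g0 mul0r add0r mulr_sumr -big_split /= big_mkord mulr_suml.
apply: eq_bigr => m _.
rewrite mulrCA -e2piD -cS [X in e2pi (- x + X)](_ : _ = (centered N m)%:~R * x + x); last first.
  by rewrite intrD mulrDl mul1r.
rewrite [- x + _]addrC addrK -mulrDl mulrAC; congr (_ * _).
by rewrite [RHS]rmorphM (rmorphD (real_complex R)) fmorphV (rmorphM (real_complex R) 2) rmorph_nat.
Qed.

End KernelDecay.

(** * The kernel matrix *)

Section KernelMatrix.
Variable R : realType.
Local Open Scope complex_scope.

Lemma kernel_matrixE (d M b N : nat) (x : 'I_M -> 'rV[R]_d) :
  (0 < N)%N -> ~~ odd N ->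
  kernel_matrix b.+2 N x = \matrix_(j, l) bspline_kernel b.+2 N (x j - x l).
Proof.
move=> N0 Ne; apply/matrixP => j l; rewrite !mxE.
rewrite /bspline_kernel.
under [RHS]eq_bigr do rewrite bspline_kernel1_fourier //.
rewrite bigA_distr_bigA /=.
rewrite [RHS](reindex _ (onW_bij _ (enum_val_bij _))).
apply: eq_bigr => c _; rewrite mul_mx_diag !mxE conj_e2pi.
rewrite [RHS]big_split /= mulrAC [RHS]mulrC; congr (_ * _); last by rewrite rmorph_prod.
rewrite -e2piD -e2pi_sum -sumrB; congr e2pi; apply: eq_bigr => t _.
by rewrite !mxE mulrBr.
Qed.

Lemma kernel_matrix_hermitian (d M beta N : nat) (x : 'I_M -> 'rV[R]_d) :
  kernel_matrix beta N x = (kernel_matrix beta N x)^t*%sesqui.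
Proof.
rewrite /kernel_matrix; set A := fourier_matrix N x; set W := weight_matrix _ _ _ _.
have WT : W^t*%sesqui = W.
  rewrite tr_diag_mx map_diag_mx; congr diag_mx; apply/rowP => c; rewrite !mxE.
  by apply/CrealP; rewrite complex_real.
by rewrite !trmx_mul !map_mxM trmxCK WT mulmxA.
Qed.

Lemma torus_dist_le d (x y : 'rV[R]_d) (k : 'rV[int]_d) :
  torus_dist x y <= `|x + map_mx intr k - y|.
Proof. by have [_] := torus_dist_is_min x y; apply; exists k. Qed.

Definition nearest_int d (z : 'rV[R]_d) : 'rV[int]_d :=
  \row_t Num.floor (z 0 t + 2^-1).

Lemma nearest_int_le d (z : 'rV[R]_d) t :
  `|(z - map_mx intr (nearest_int z)) 0 t| <= 2^-1.
Proof.
rewrite !mxE; have /andP[f1 f2] := floor_itv (z 0 t + 2^-1).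
by rewrite ler_norml; move: f2; rewrite intrD; lra.
Qed.

(** Only the largest coordinate is used for decay; the other factors are at
    most 1. *)
Lemma norm_bspline_kernel_decay (d b N : nat) (z : 'rV[R]_d) (k : 'rV[int]_d)
    (y := z - map_mx intr k) (delta : R := b.+2%:R / N%:R) :
  (0 < N)%N -> ~~ odd N -> delta < 1 ->
  0 < `|y| -> (forall t, `|y 0 t| <= 2^-1) ->
  `|bspline_kernel b.+2 N z| <=
    ((2 * (1 - delta))^-1 * (delta / (2 * `|y|)) ^+ b.+2)%:C.
Proof.
move=> N0 Ne d1 y0 yh.
have [t ty] := mx_norm_attained y0.
have BE s : bspline_kernel1 b.+2 N (z 0 s) = bspline_kernel1 b.+2 N (y 0 s).
  have -> : z 0 s = y 0 s + (k 0 s)%:~R by rewrite !mxE subrK.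
  exact: bspline_kernel1_int.
rewrite /bspline_kernel normr_prod (bigD1 t) //= BE -ty.
apply: (le_trans (y := `|bspline_kernel1 b.+2 N (y 0 t)| * 1)).
  rewrite ler_wpM2l //; apply: prodr_ile1 => s _.
  by rewrite normr_ge0 norm_bspline_kernel1_le1.
rewrite mulr1; apply: norm_bspline_kernel1_decay => //.
by rewrite -normr_gt0 ty.
Qed.

Lemma bspline_kernel_0 (d b N : nat) : (0 < N)%N -> ~~ odd N ->
  b.+2%:R / N%:R < 1 :> R -> bspline_kernel b.+2 N (0 : 'rV[R]_d) = 1.
Proof.
by move=> N0 Ne d1; apply: big1 => t _; rewrite mxE bspline_kernel1_0.
Qed.

(** The differences to a fixed node, reduced to the fundamental cube, form a
    q-separated family of points at distance at least q from the origin. *)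
Lemma kernel_row_sum (d M b N : nat) (x : 'I_M -> 'rV[R]_d) (q : R)
    (delta : R := b.+2%:R / N%:R) (j : 'I_M) :
  b.+1 = d -> (0 < N)%N -> ~~ odd N -> delta < 1 ->
  is_separation_distance x q -> 0 < q ->
  \sum_(l | l != j) `|bspline_kernel b.+2 N (x j - x l)| <=
    ((2 * (1 - delta))^-1 * (delta / (2 * q)) ^+ b.+2 *
      ((2 ^ d * (2 ^ d - 1))%:R * (5 / 3)))%:C.
Proof.
move=> bd N0 Ne d1 [_ sep] q0.
pose k l := nearest_int (x j - x l).
pose y l := x j - x l - map_mx intr (k l).
have far l : l != j -> q <= `|y l|.
  move=> lj; apply: (le_trans (y := torus_dist (x j) (x l))).
    by apply: sep; exists j, l; rewrite eq_sym.
  have := torus_dist_le (x j) (x l) (- k l).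
  by rewrite map_mxN /y addrAC.
have ysep l l' : l != j -> l' != j -> l != l' -> q <= `|y l - y l'|.
  move=> _ _ ll; apply: (le_trans (y := torus_dist (x l') (x l))).
    by apply: sep; exists l', l; rewrite eq_sym.
  have := torus_dist_le (x l') (x l) (k l' - k l).
  rewrite map_mxB; suff -> : x l' + (map_mx intr (k l') - map_mx intr (k l)) - x l = y l - y l' by [].
  by apply/rowP => t; rewrite !mxE; ring.
have C0 : 0 <= (2 * (1 - delta))^-1 * (delta / (2 * q)) ^+ b.+2.
  rewrite mulr_ge0 ?invr_ge0 ?exprn_ge0 ?divr_ge0 ?mulr_ge0 //; last exact: ltW.
  by rewrite subr_ge0 ltW.
apply: (le_trans (y := (\sum_(l | l != j) (2 * (1 - delta))^-1 *
    (delta / (2 * q)) ^+ b.+2 * (q / `|y l|) ^+ b.+2)%:C)); last first.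
  rewrite lecR -mulr_sumr ler_wpM2l // bd.
  by apply: sum_separated_le => //; rewrite -bd.
rewrite rmorph_sum; apply: ler_sum => l lj.
have y0 : 0 < `|y l| by exact: lt_le_trans (far l lj).
apply: (le_trans (norm_bspline_kernel_decay N0 Ne d1 y0 (nearest_int_le _))).
rewrite lecR -mulrA -exprMn -/(y l).
suff -> : delta / (2 * `|y l|) = delta / (2 * q) * (q / `|y l|) by [].
by field; rewrite !gt_eqF.
Qed.

End KernelMatrix.

(** * The numerical constant *)

Section Constants.
Variable R : realType.

Lemma bernoulli_ineq (h : R) n : 0 <= h -> 1 + n%:R * h <= (1 + h) ^+ n.
Proof.
move=> h0; elim: n => [|n IHn]; first by rewrite mul0r addr0 expr0.
rewrite exprS -natr1.
apply: (le_trans (y := (1 + h) * (1 + n%:R * h))); last by rewrite ler_wpM2l //; lra.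
have : 0 <= n%:R * h * h by rewrite !mulr_ge0.
lra.
Qed.

(** The sequence (1 + 1 / d) ^ (d + 1) decreases, by Bernoulli's inequality. *)
Lemma ratio_pow_le d : (3 <= d)%N ->
  (d.+1%:R / d%:R) ^+ d.+1 <= 256 / 81 :> R.
Proof.
elim: d => // d IHd; rewrite ltnS leq_eqVlt => /predU1P[<-|d3].
  by rewrite [leLHS](_ : _ = 256 / 81) //; field.
apply: le_trans (IHd d3).
have d0 : 0 < d%:R :> R by rewrite ltr0n (leq_trans _ d3).
rewrite -(natr1 d.+1) -(natr1 d); set u := d%:R in d0 *.
rewrite (exprS _ d.+1) -ler_pdivlMr ?exprn_gt0 ?divr_gt0 ?addr_gt0 //.
rewrite -expr_div_n.
have -> : (u + 1) / u / ((u + 1 + 1) / (u + 1)) = 1 + (u * (u + 1 + 1))^-1.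
  by field; rewrite !gt_eqF //; lra.
apply: le_trans (bernoulli_ineq d.+1 _); last by rewrite invr_ge0 mulr_ge0; lra.
rewrite -(natr1 d) -/u.
have -> : (u + 1 + 1) / (u + 1) = 1 + (u + 1)^-1 by field; rewrite gt_eqF //; lra.
rewrite lerD2l ler_pdivlMr; last by rewrite mulr_gt0; lra.
rewrite mulrC ler_pdivrMr; last lra.
nra.
Qed.

(** As delta <= r, this says that the bound for the
    row sums does not exceed (2 d / (N q)) ^ (d + 1). The cases d = 1 and d = 2
    are numerical; beyond them r <= 1 / 3 and (1 + 1 / d) ^ (d + 1) <= 256 / 81
    suffice. *)
Lemma gershgorin_constant_le d (r : R := d.+1%:R / (4 * d%:R)) : (0 < d)%N ->
  r ^+ d.+1 * ((2 ^ d * (2 ^ d - 1))%:R * 5) <= 6 * (1 - r).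
Proof.
rewrite /r; case: d r => [//|[|[|d]]] r _.
- have -> : 2%:R / (4 * 1%:R) = 2^-1 :> R by field.
  by rewrite (_ : (2 ^ 1 * (2 ^ 1 - 1))%N = 2%N) // !exprS expr0; lra.
- have -> : 3%:R / (4 * 2%:R) = 3 / 8 :> R by field.
  by rewrite (_ : (2 ^ 2 * (2 ^ 2 - 1))%N = 12%N) // !exprS expr0; lra.
move: (d.+3) (isT : 2 < d.+3)%N => {d r} d d3.
have d0 : 3 <= d%:R :> R by rewrite (ler_nat _ 3).
have r3 : d.+1%:R / (4 * d%:R) <= 3^-1 :> R.
  by rewrite ler_pdivrMr; [rewrite -natr1|]; lra.
suff : (d.+1%:R / (4 * d%:R)) ^+ d.+1 * ((2 ^ d * (2 ^ d - 1))%:R * 5) <= 4 :> R by lra.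
have h := ratio_pow_le d3.
have pow : (2 ^ d * (2 ^ d - 1))%:R <= 4 ^+ d :> R.
  rewrite -natrX ler_nat (expnMn 2 2) leq_mul // leq_subr //.
have -> : d.+1%:R / (4 * d%:R) = (d.+1%:R / d%:R) * 4^-1 :> R by field; lra.
rewrite exprMn -mulrA; set t := (_ / _) ^+ _ in h *.
have t0 : 0 <= t by rewrite exprn_ge0 // divr_ge0.
apply: (le_trans (y := t * (4^-1 * 5))); last lra.
rewrite ler_wpM2l // mulrA ler_wpM2r //.
rewrite exprS -mulrA -[leRHS]mulr1 ler_wpM2l // exprVn mulrC ler_pdivrMr ?exprn_gt0 //.
by rewrite mul1r.
Qed.

End Constants.

(** * Stability of the Fourier and kernel matrices *)

Theorem corollary4p7 (R : realType) (d M : nat) (hd : (0 < d)%N)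
    (x : 'I_M -> 'rV[R]_d) (hx : forall j, torus (x j))
    (q : R) (hsep : is_separation_distance x q) (hq : 0 < q <= 2^-1)
    (N : nat) (hN_even : ~~ odd N) (hN : 2 * d%:R / q < N%:R) :
  \rank (fourier_matrix N x) = M /\
  kernel_matrix d.+1 N x =
    \matrix_(j, l) bspline_kernel d.+1 N (x j - x l) /\
  exists lambda Lambda : R,
    [/\ smallest_eigenvalue (kernel_matrix d.+1 N x) lambda,
        largest_eigenvalue (kernel_matrix d.+1 N x) Lambda,
        0 < 1 - (2 * d%:R / (N%:R * q)) ^+ d.+1,
        1 - (2 * d%:R / (N%:R * q)) ^+ d.+1 <= lambda <= 1 &
        1 <= Lambda <= 1 + (2 * d%:R / (N%:R * q)) ^+ d.+1].
Proof.
case: d hd x hx hsep hN => [//|b] hd x hx hsep hN.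
case/andP: hq => q0 q2.
have dR : 1 <= b.+1%:R :> R by rewrite ler1n.
have qV : 2 <= q^-1 by rewrite -[leLHS]invrK lef_pV2 ?posrE ?invr_gt0.
(* The separation distance is at most 1/2, so N > 2 d / q >= 4 d. *)
have N4 : 4 * b.+1%:R <= N%:R :> R.
  apply/ltW/(le_lt_trans _ hN).
  have : 2 * b.+1%:R * 2 <= 2 * b.+1%:R / q by rewrite ler_wpM2l // mulr_ge0.
  lra.
have NR : 0 < N%:R :> R by lra.
have N0 : (0 < N)%N by rewrite -(ltr0n R).
set rho := (2 * b.+1%:R / (N%:R * q)) ^+ b.+2.
pose delta : R := b.+2%:R / N%:R.
pose r : R := b.+2%:R / (4 * b.+1%:R).
have dr : delta <= r.
  by rewrite /delta /r ler_wpM2l // lef_pV2 ?posrE //; lra.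
have r2 : r <= 2^-1.
  by rewrite /r ler_pdivrMr; [rewrite -natr1|]; lra.
have delta1 : delta < 1 by lra.
have delta0 : 0 <= delta by rewrite divr_ge0 // ltW.
have base0 : 0 <= 2 * b.+1%:R / (N%:R * q) by rewrite divr_ge0 ?mulr_ge0 // ltW.
have rho1 : rho < 1.
  apply: exprn_ilt1 => //.
  by rewrite ltr_pdivrMr ?mulr_gt0 // mul1r -ltr_pdivrMr.
have KE := kernel_matrixE b x N0 hN_even.
have Kherm := kernel_matrix_hermitian b.+2 N x.
have Kdiag j : kernel_matrix b.+2 N x j j = 1.
  by rewrite KE mxE subrr bspline_kernel_0.
(* Replacing delta by r in 1 - delta only weakens the estimate. *)
have const : (2 * (1 - delta))^-1 * (delta / (2 * q)) ^+ b.+2 *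
      ((2 ^ b.+1 * (2 ^ b.+1 - 1))%:R * (5 / 3)) <= rho.
  have -> : delta / (2 * q) = 2 * b.+1%:R / (N%:R * q) * r.
    by rewrite /delta /r; field; rewrite !gt_eqF //; lra.
  rewrite exprMn -/rho; have := gershgorin_constant_le R (ltn0Sn b); rewrite -/r.
  move: ((2 ^ b.+1 * (2 ^ b.+1 - 1))%:R) (r ^+ b.+2) => P Q h.
  have -> : (2 * (1 - delta))^-1 * (rho * Q) * (P * (5 / 3)) =
      rho * ((2 * (1 - delta))^-1 * (Q * (P * (5 / 3)))) by ring.
  rewrite -[leRHS]mulr1 ler_wpM2l ?exprn_ge0 //.
  by rewrite ler_pdivrMl ?mulr1; lra.
have Krows j : \sum_(l | l != j) `|kernel_matrix b.+2 N x j l| <= (rho%:C)%C.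
  apply: (le_trans (y := ((2 * (1 - delta))^-1 * (delta / (2 * q)) ^+ b.+2 *
      ((2 ^ b.+1 * (2 ^ b.+1 - 1))%:R * (5 / 3)))%:C)%C); last by rewrite lecR.
  under eq_bigr do rewrite KE mxE.
  exact: kernel_row_sum.
have M0 : (0 < M)%N.
  by have [[j _] _] := hsep; apply: leq_ltn_trans (ltn_ord j).
have [lambda [Lambda [small large lam Lam]]] :=
  near_identity_eigenvalues Kherm Kdiag Krows M0.
split; last first.
  by split => //; exists lambda, Lambda; split; rewrite ?subr_gt0.
have lam0 : 0 < lambda by case/andP: lam => h _; lra.
have /eqP rk : row_free (kernel_matrix b.+2 N x).
  exact: row_free_smallest_eigenvalue_gt0 small lam0.
apply/eqP; rewrite eqn_leq rank_leq_row -[leqLHS]rk /kernel_matrix -mulmxA.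
exact: mxrankM_maxl.
Qed.
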